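(* Let $n\ge 3$ and let $f_0,\dots,f_{n-1},d_0,\dots,d_{n-1}$ be analytic functions of $t$ on a domain in $\mathbb{C}^*$, with $\sum_{j=0}^{n-1} d_j=0$ and $\prod_{j=0}^{n-1} f_j=t$ (so no $f_j$ vanishes). Index rows and columns of $n\times n$ matrices by $0,\dots,n-1$. Let $A=A(z,t)$ be the matrix whose nonzero entries are $$A_{j,j}=d_j\ (0\le j\le n-1),\quad A_{j,j+1}=1\ (0\le j\le n-3),\quad A_{n-2,n-1}=\tfrac1z,\quad A_{n-1,0}=1,$$ $$A_{0,n-1}=f_0,\quad A_{j,j-1}=f_j\ (1\le j\le n-2),\quad A_{n-1,n-2}=f_{n-1}z,$$ and let $B=B(z,t)$ be the matrix whose nonzero entries are $B_{0,n-1}=f_0$, $B_{j,j-1}=f_j$ $(1\le j\le n-2)$, $B_{n-1,n-2}=f_{n-1}z$. Then the operators $z\frac{d}{dz}+A$ and $t\frac{d}{dt}+B$ commute if and only if (with $'=\frac{d}{dt}$) $$t\frac{f_0'}{f_0}=d_0-d_{n-1},\qquad t\frac{f_j'}{f_j}=d_j-d_{j-1}\ (1\le j\le n-2),\qquad t\frac{f_{n-1}'}{f_{n-1}}=d_{n-1}-d_{n-2}+1,$$ $$t\,d_j'=f_{j+1}-f_j\ (0\le j\le n-2),\qquad t\,d_{n-1}'=f_0-f_{n-1}.$$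
   Context: The operators act on vectors of length $n$ of functions of $z$ and $t$. For matrices $A,B$ depending on $z,t$, the operators $z\frac{d}{dz}+A$ and $t\frac{d}{dt}+B$ commute (form a Lax pair) if and only if $t\frac{\partial A}{\partial t}=z\frac{\partial B}{\partial z}+[A,B]$ identically in $z$, where $[A,B]=AB-BA$. *)

(* Defs.v *)
From HB Require Import structures.
From mathcomp Require Import all_boot all_order all_algebra.
From mathcomp Require Import all_classical all_reals all_analysis.
From mathcomp Require Import complex.

Set Implicit Arguments.
Unset Strict Implicit.
Unset Printing Implicit Defensive.

Import Order.TTheory GRing.Theory Num.Theory.
Import numFieldNormedType.Exports.

Local Open Scope classical_set_scope.
Local Open Scope ring_scope.

(* The complex numbers R[i], packaged as a numFieldType so that they carry the
   topology and the (complex) derivative that MathComp-Analysis puts on every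
   numFieldType.  In this type 0 < r means that r is real and positive, and the
   modulus `|z| is a nonnegative real element. *)
Definition Cplx (R : realType) : numFieldType := R[i]%C.

Section Defs.
Variable R : realType.
Local Notation C := (Cplx R).

Definition domain (D : set C) := [/\ D !=set0, open D & connected D].

(* f is the sum of a convergent power series around every point of D. *)
Definition analytic_on (D : set C) (f : C -> C) :=
  forall t0, D t0 ->
  exists (a : nat -> C) (r : C), 0 < r /\
    forall h : C, `|h| < r ->
      series (fun i => a i * h ^+ i) @ \oo --> f (t0 + h).

(* F is the sum of a double power series around every point (z0, t0) of U, the
   series converging absolutely on the polydisc of radius r.  Because of the
   absolute convergence, summing over squares is as good as any other order. *)
Definition analytic2_on (U : set (C * C)) (F : C -> C -> C) :=
  forall z0 t0, U (z0, t0) ->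
  exists (a : nat -> nat -> C) (r : C), 0 < r /\
    (exists M : C, forall N : nat,
       \sum_(i < N) \sum_(j < N) `|a i j| * r ^+ i * r ^+ j <= M) /\
    forall h k : C, `|h| < r -> `|k| < r ->
      (fun N : nat => \sum_(i < N) \sum_(j < N) a i j * h ^+ i * k ^+ j)
        @ \oo --> F (z0 + h) (t0 + k).

Section Operators.
Variable n : nat.

(* Vectors of length n of functions of (z, t). *)
Definition vfun := C -> C -> 'cV[C]_n.

Definition vanalytic_on (U : set (C * C)) (Y : vfun) :=
  forall i : 'I_n, analytic2_on U (fun z t => Y z t i 0).

(* z d/dz + A *)
Definition zDplus (A : C -> C -> 'M[C]_n) (Y : vfun) : vfun := fun z t =>
  z *: (\col_i derive1 (fun w : C => Y w t i 0) z) + A z t *m Y z t.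

(* t d/dt + B *)
Definition tDplus (B : C -> C -> 'M[C]_n) (Y : vfun) : vfun := fun z t =>
  t *: (\col_i derive1 (fun s : C => Y z s i 0) t) + B z t *m Y z t.

Definition commute_on (U : set (C * C)) (P Q : vfun -> vfun) :=
  forall Y : vfun, vanalytic_on U Y ->
  forall z t, U (z, t) -> P (Q Y) z t = Q (P Y) z t.

(* The sequences f, d : nat -> C -> C are only used at indices below n.  The
   branches below are mutually exclusive as soon as 3 <= n. *)
Definition matB (f : nat -> C -> C) (z t : C) : 'M[C]_n :=
  \matrix_(i < n, j < n)
    if (i == 0 :> nat)%N && (j == n - 1 :> nat)%N then f 0%N t
    else if (1 <= i <= n - 2)%N && (j == i - 1 :> nat)%N then f i t
    else if (i == n - 1 :> nat)%N && (j == n - 2 :> nat)%N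
      then f (n - 1)%N t * z
    else 0.

Definition matA (f d : nat -> C -> C) (z t : C) : 'M[C]_n :=
  \matrix_(i < n, j < n)
    if i == j then d i t
    else if (i <= n - 3)%N && (j == i + 1 :> nat)%N then 1
    else if (i == n - 2 :> nat)%N && (j == n - 1 :> nat)%N then 1 / z
    else if (i == n - 1 :> nat)%N && (j == 0 :> nat)%N then 1
    else if (i == 0 :> nat)%N && (j == n - 1 :> nat)%N then f 0%N t
    else if (1 <= i <= n - 2)%N && (j == i - 1 :> nat)%N then f i t
    else if (i == n - 1 :> nat)%N && (j == n - 2 :> nat)%N
      then f (n - 1)%N t * z
    else 0.

End Operators.
End Defs.

(* Main.v *)
Require Import Defs.
From HB Require Import structures.
From mathcomp Require Import all_boot all_order all_algebra.
From mathcomp Require Import all_classical all_reals all_analysis.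
From mathcomp Require Import complex ring zify.

(* For Y given by double power series, all the derivatives of Y cancel in
   [z d/dz + A, t d/dt + B] Y because mixed partial derivatives commute, which
   leaves (z dB/dz - t dA/dt + [A, B]) Y; constant vectors Y show that
   commutation amounts to the vanishing of this matrix.
   Indexing cyclically, A = diag d + U + B where U sits on the entries (i, i + 1)
   and B on the entries (i, i - 1).  Hence [A, B] = [diag d, B] + [U, B] has the
   entry (d_i - d_(i-1)) B_(i,i-1) in position (i, i - 1), where it yields the
   equations for f, and f_(i+1) - f_i on the diagonal, where it yields the
   equations for d. *)

Set Implicit Arguments.
Unset Strict Implicit.
Unset Printing Implicit Defensive.

Import Order.TTheory GRing.Theory Num.Theory.
Import numFieldNormedType.Exports.

Local Open Scope classical_set_scope.
Local Open Scope ring_scope.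

(** * Derivatives of limits of polynomials *)

Lemma norm_lim_le (K : numFieldType) (u : nat -> K) (l M : K) :
  0 <= M -> u @ \oo --> l -> (forall N, `|u N| <= M) -> `|l| <= M.
Proof.
move=> M0 /cvgrPdist_lt ul uM.
(* The order of [K] is only partial, but [|l|] and [M] are both real and hence comparable. *)
rewrite real_leNgt ?ger0_real//; apply/negP => Ml.
have /ul[N _ /(_ N (leqnn N))] : 0 < `|l| - M by rewrite subr_gt0.
rewrite ltrBrDr => lM; have := le_lt_trans (ler_normD (l - u N) (u N)) (le_lt_trans _ lM).
by rewrite subrK ltxx lerD2l uM => /(_ isT).
Qed.

(** Dividing the quadratic error by [k] leaves at most [M * |k|], which tends to 0. *)
Lemma is_derive_quadratic (K : numFieldType) (g : K -> K) (x c r M : K) :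
  0 < r -> 0 <= M ->
  (forall k, `|k| < r -> `|g (x + k) - g x - k * c| <= M * `|k| ^+ 2) ->
  is_derive x 1 g c.
Proof.
move=> r0 M0 gM.
have dg : h^-1 *: (g (h *: 1 + x) - g x) @[h --> 0^'] --> c.
  apply/cvgrPdist_lt => e e0; near=> h.
  have h0 : h != 0 by near: h; exact: nbhs_dnbhs_neq.
  have hr : `|h| < r by near: h; apply: dnbhs0_lt.
  (* [M + 1] replaces [M] in the denominator because [M] may be 0. *)
  have he : `|h| < e / (M + 1).
    by near: h; apply: dnbhs0_lt; rewrite divr_gt0// ltr_wpDl.
  rewrite /GRing.scale/= mulr1 [h + x]addrC distrC.
  rewrite [X in `|X|](_ : _ = h^-1 * (g (x + h) - g x - h * c)); last first.
    by rewrite [RHS]mulrBr mulKf.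
  rewrite normrM normfV ltr_pdivrMl ?normr_gt0//.
  apply: (le_lt_trans (gM _ hr)); rewrite expr2 mulrCA ltr_pM2l ?normr_gt0//.
  rewrite ltr_pdivlMr ?ltr_wpDl// in he.
  by apply: le_lt_trans he; rewrite mulrC ler_wpM2l// lerDl.
by split; [apply/cvg_ex; exists c | exact/cvg_lim].
Unshelve. all: by end_near. Qed.

Lemma is_derive_mulrb (K : numFieldType) (g : K -> K) (x dg : K) (b : bool) :
  is_derive x 1 g dg -> is_derive x 1 (fun w => g w *+ b) (dg *+ b).
Proof. by case: b => // _; exact: is_derive_cst. Qed.

Lemma big_ord_recl2 (V : nmodType) (N : nat) (F : nat -> V) :
  \sum_(j < N.+2) F j = F 0%N + (F 1%N + \sum_(i < N) F i.+2).
Proof. by rewrite !big_ord_recl. Qed.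

(* [b N j] is the j-th coefficient of an N-th approximation of g around x; it
   may depend on N because the coefficients of a double series, read as a series
   in one variable, are themselves limits of partial sums. *)
Lemma is_derive_lim_poly (K : numFieldType) (g : K -> K) (x c r M : K)
    (b : nat -> nat -> K) :
  0 < r -> (forall N, \sum_(j < N) `|b N j| * r ^+ j <= M) ->
  (forall k, `|k| < r -> (fun N => \sum_(j < N) b N j * k ^+ j) @ \oo --> g (x + k)) ->
  (fun N => b N 1%N) @ \oo --> c ->
  is_derive x 1 g c.
Proof.
move=> r0 bM bg bc.
have M0 : 0 <= M by have := bM 0%N; rewrite big_ord0.
apply: (@is_derive_quadratic _ _ _ _ r (M / r ^+ 2)) => // [|k kr].
  by rewrite divr_ge0// exprn_ge0// ltW.
have b0 : (fun N => b N 0%N) @ \oo --> g x.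
  rewrite -[x in g x]addr0; have := bg 0; rewrite normr0 => /(_ r0).
  apply: cvg_trans; apply: near_eq_cvg; near=> N.
  (* At [k = 0] only the term of degree 0 survives, provided that the sum is not empty. *)
  have /prednK <- : (0 < N)%N by near: N; exists 1%N.
  rewrite big_ord_recl/= mulr1 big1 ?addr0// => i _.
  by rewrite expr0n mulr0.
have lim : (fun N => \sum_(j < N) b N j * k ^+ j - b N 0%N - k * b N 1%N) @ \oo -->
    g (x + k) - g x - k * c.
  by apply: cvgB; [apply: cvgB => //; exact: bg | exact: cvgMr].
(* From two terms on, those of degree 0 and 1 can be split off; they cancel, and the tail remains to
   be bounded. *)
rewrite -(cvg_shiftn 2) in lim.
apply: norm_lim_le lim _ => [|N /=].
  by rewrite mulr_ge0 ?exprn_ge0// divr_ge0 ?exprn_ge0 ?(ltW r0).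
rewrite addn2 (big_ord_recl2 N (fun j => b N.+2 j * k ^+ j)) expr0 mulr1 expr1.
rewrite [X in `|X|](_ : _ = \sum_(i < N) b N.+2 i.+2 * k ^+ i.+2); last ring.
rewrite mulrAC ler_pdivlMr ?exprn_gt0//.
have := bM N.+2; rewrite (big_ord_recl2 N (fun j => `|b N.+2 j| * r ^+ j)) => {}bM.
have {}bM : \sum_(i < N) `|b N.+2 i.+2| * r ^+ i.+2 <= M.
  by apply: le_trans bM; rewrite addrA lerDr addr_ge0// mulr_ge0 ?exprn_ge0// ltW.
apply: (le_trans _ (ler_wpM2r (exprn_ge0 2 (normr_ge0 k)) bM)).
rewrite mulr_suml.
apply: (@le_trans _ _ (\sum_(i < N) `|b N.+2 i.+2 * k ^+ i.+2| * r ^+ 2)).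
  by rewrite -mulr_suml ler_wpM2r ?exprn_ge0 ?(ltW r0)// ler_norm_sum.
(* Since [|k| < r], one has [|k| ^+ (i + 2) * r ^+ 2 <= r ^+ (i + 2) * |k| ^+ 2]. *)
apply: ler_sum => i _; rewrite normrM normrX -[leLHS]mulrA -[leRHS]mulrA.
rewrite ler_wpM2l// [leRHS]mulrC -(addn2 i) !exprD -[leLHS]mulrA [leRHS]mulrCA.
rewrite [_ * r ^+ 2]mulrC -[leRHS]mulrC [leRHS]mulrC [_ * `|k| ^+ 2]mulrC.
rewrite ler_wpM2r ?mulr_ge0 ?exprn_ge0 ?(ltW r0)//.
by apply: lerXn2r; rewrite ?nnegrE ?(ltW r0) ?(ltW kr).
Unshelve. all: by end_near. Qed.

(** * Complex double power series and their mixed derivatives *)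

Lemma normc_ge_Im (R : rcfType) (x : R[i]) : (`|complex.Im x|)%:C%C <= `|x|.
Proof.
by case: x => a b; rewrite normc_def/= lecR -sqrtr_sqr ler_wsqrtr// lerDr sqr_ge0.
Qed.

Lemma normc_le_ReIm (R : rcfType) (x : R[i]) :
  `|x| <= (`|complex.Re x| + `|complex.Im x|)%:C%C.
Proof.
case: x => a b; rewrite normc_def/= lecR -[leRHS]ger0_norm ?addr_ge0//.
rewrite -[leRHS]sqrtr_sqr ler_wsqrtr//.
by rewrite sqrrD !real_normK ?num_real// lerD2r lerDl mulrn_wge0// mulr_ge0.
Qed.

(** The modulus dominates the real and imaginary parts, so both real series converge absolutely, and
    their sums are the parts of the limit. *)
Lemma is_cvg_abs_series (R : realType) (b : nat -> Cplx R) (M : Cplx R) :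
  (forall N, \sum_(i < N) `|b i| <= M) ->
  exists l : Cplx R, (fun N => \sum_(i < N) b i) @ \oo --> l.
Proof.
move=> bM.
have cvg_part (p : {additive R[i] -> R}) : (forall x : R[i], (`|p x|)%:C%C <= `|x|) ->
    cvgn (series (fun i => p (b i))).
  move=> px; apply: normed_cvg; apply: nondecreasing_is_cvgn.
    by apply: nondecreasing_series => *; exact: normr_ge0.
  (* [M] bounds a nonnegative sum, hence is itself real and equal to its real part. *)
  exists (complex.Re (M : R[i])) => _ [N _ <-].
  rewrite -lecR RRe_real; last first.
    by apply: ger0_real; apply: le_trans (bM N); exact: sumr_ge0.
  apply: le_trans (bM N); rewrite /= seriesEord/= raddf_sum.
  by apply: ler_sum => i _; exact: px.
have /cvg_ex[/= x cx] : cvgn (series (fun i => complex.Re (b i))).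
  by apply: (cvg_part (@complex.Re R : {additive R[i] -> R})) => z; exact: normc_ge_Re.
have /cvg_ex[/= y cy] : cvgn (series (fun i => complex.Im (b i))).
  apply: (cvg_part (@complex.Im R : {additive R[i] -> R})) => z.
  exact: normc_ge_Im.
exists (Complex x y : Cplx R).
apply/(@cvgrPdist_lt (Cplx R) (Cplx R)) => e e0.
have eE : e = (complex.Re (e : R[i]))%:C%C by rewrite RRe_real// ger0_real// ltW.
have e20 : 0 < complex.Re (e : R[i]) / 2.
  by rewrite divr_gt0// -ltcR -eE.
rewrite seriesEord/= in cx; move/cvgrPdist_lt: cx => /(_ _ e20) cx.
rewrite seriesEord/= in cy; move/cvgrPdist_lt: cy => /(_ _ e20) cy.
near=> N.
have xN : `|x - \sum_(i < N) complex.Re (b i)| < complex.Re (e : R[i]) / 2.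
  by near: N.
have yN : `|y - \sum_(i < N) complex.Im (b i)| < complex.Re (e : R[i]) / 2.
  by near: N.
apply: le_lt_trans (normc_le_ReIm _) _.
rewrite [ltRHS]eE ltcR raddfB (raddfB (@complex.Im R : {additive R[i] -> R})).
by rewrite !raddf_sum/= !sumrN [ltRHS]splitr ltrD.
Unshelve. all: by end_near. Qed.

(* Near z0 the inner derivative is the series of the [a i 1] (z - z0)^i.  The two
   orders of differentiation thus both give [a 1 1] at the centre, which is all
   that is needed since the centre is arbitrary. *)
Lemma double_series_derive (R : realType) (F : Cplx R -> Cplx R -> Cplx R)
    (z0 t0 r M : Cplx R) (a : nat -> nat -> Cplx R) :
  0 < r ->
  (forall N : nat, \sum_(i < N) \sum_(j < N) `|a i j| * r ^+ i * r ^+ j <= M) ->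
  (forall h k : Cplx R, `|h| < r -> `|k| < r ->
    (fun N : nat => \sum_(i < N) \sum_(j < N) a i j * h ^+ i * k ^+ j)
      @ \oo --> F (z0 + h) (t0 + k)) ->
  (forall h, `|h| < r -> derivable (F (z0 + h)) t0 1) /\
  is_derive z0 1 (fun z => derive1 (F z) t0) (a 1%N 1%N).
Proof.
move=> r0 aM aF.
(* The square of side [N + 2] contains the first [N] entries of column 1, and that column carries a
   factor [r]. *)
have a1M N : \sum_(i < N) `|a i 1%N| * r ^+ i <= M / r.
  rewrite ler_pdivlMr// mulr_suml.
  have S0 (i0 j0 : nat) : 0 <= `|a i0 j0| * r ^+ i0 * r ^+ j0.
    by rewrite !mulr_ge0 ?exprn_ge0// ltW.
  apply: le_trans (aM N.+2).
  rewrite (big_ord_recr N.+1) (big_ord_recr N)/= -addrA.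
  apply: (@le_trans _ _ (\sum_(i < N) \sum_(j < N.+2) `|a i j| * r ^+ i * r ^+ j)).
    apply: ler_sum => i _.
    rewrite (big_ord_recl2 N (fun j => `|a i j| * r ^+ i * r ^+ j)) expr1.
    by rewrite addrCA lerDl; apply: addr_ge0 => //; apply: sumr_ge0.
  by rewrite lerDl; apply: addr_ge0; apply: sumr_ge0.
have row h : `|h| < r -> exists c, is_derive t0 1 (F (z0 + h)) c /\
    (fun N => \sum_(i < N) a i 1%N * h ^+ i) @ \oo --> c.
  move=> hr.
  have [N|c cc] := @is_cvg_abs_series R (fun i => a i 1%N * h ^+ i) (M / r).
    apply: le_trans (a1M N); apply: ler_sum => i _.
    by rewrite normrM normrX ler_wpM2l// lerXn2r ?nnegrE ?(ltW r0) ?(ltW hr).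
  exists c; split; last exact: cc.
  apply: (@is_derive_lim_poly _ _ _ _ r M (fun N j => \sum_(i < N) a i j * h ^+ i) r0 _ _ cc).
    move=> N; apply: le_trans (aM N); rewrite exchange_big/=; apply: ler_sum => j _.
    rewrite -mulr_suml ler_wpM2r ?exprn_ge0 ?(ltW r0)//.
    apply: le_trans (ler_norm_sum _ _ _) _; apply: ler_sum => i _.
    by rewrite normrM normrX ler_wpM2l// lerXn2r ?nnegrE ?(ltW r0) ?(ltW hr).
  move=> k kr.
  rewrite [X in X @ _](_ : _ = fun N : nat => \sum_(i < N) \sum_(j < N) a i j * h ^+ i * k ^+ j).
    exact: aF.
  apply/funext => N; rewrite exchange_big/=.
  by apply: eq_bigr => j _; rewrite mulr_suml.
split=> [h /row[c [dc _]]|]; first exact: ex_derive.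
apply: (@is_derive_lim_poly _ _ _ _ r (M / r) (fun _ j => a j 1%N)) => //.
  by move=> k /row[c [dc]]; rewrite derive1E derive_val.
exact: cvg_cst.
Qed.

(** [double_series_derive] applies to [F] and, with transposed coefficients, to [F] with its
    variables exchanged. Transposition fixes [a 1 1], so the mixed derivatives agree. *)
Lemma analytic2_derive (R : realType) (U : set (Cplx R * Cplx R))
    (F : Cplx R -> Cplx R -> Cplx R) (z0 t0 : Cplx R) :
  analytic2_on U F -> U (z0, t0) ->
  exists c, [/\ derivable (F^~ t0) z0 1, derivable (F z0) t0 1,
    is_derive z0 1 (fun z => derive1 (F z) t0) c &
    is_derive t0 1 (fun t => derive1 (F^~ t) z0) c].
Proof.
move=> FU /FU[a [r [r0 [[M aM] aF]]]]; exists (a 1%N 1%N).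
have [dt dzt] := double_series_derive r0 aM aF.
have [N|h k hr kr|dz dtz] := @double_series_derive R (fun t z => F z t) t0 z0 r M
    (fun i j => a j i) r0.
- rewrite exchange_big/=; apply: le_trans (aM N).
  by under eq_bigr do under eq_bigr do rewrite mulrAC.
- rewrite [X in X @ _](_ : _ = fun N : nat => \sum_(i < N) \sum_(j < N) a i j * k ^+ i * h ^+ j).
    exact: aF.
  apply/funext => N; rewrite exchange_big/=.
  by under eq_bigr do under eq_bigr do rewrite mulrAC.
split => //.
- by have := dz 0; rewrite normr0 addr0; exact.
- by have := dt 0; rewrite normr0 addr0; exact.
Qed.

(** Makes constant vectors admissible as test functions for commutation. *)
Lemma analytic2_on_cst (R : realType) (U : set (Cplx R * Cplx R)) (c : Cplx R) :
  analytic2_on U (fun _ _ => c).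
Proof.
move=> z0 t0 _; exists (fun i j => if (i == 0%N) && (j == 0%N) then c else 0), 1.
split => //; split.
  exists `|c| => -[|N]; first by rewrite big_ord0.
  rewrite big_ord_recl [X in _ + X]big1 ?addr0 => [|i _]; last first.
    by rewrite big1// => j _; rewrite normr0 !mul0r.
  rewrite big_ord_recl [X in _ + X]big1 ?addr0 => [|i _]; last first.
    by rewrite normr0 !mul0r.
  by rewrite !mulr1.
move=> h k _ _; apply: cvg_near_cst; near=> N.
have /prednK <- : (0 < N)%N by near: N; exists 1%N.
rewrite big_ord_recl [X in _ + X]big1 ?addr0 => [|i _]; last first.
  by rewrite big1// => j _; rewrite !mul0r.
rewrite big_ord_recl [X in _ + X]big1 ?addr0 => [|i _]; last first.
  by rewrite !mul0r.
by rewrite !mulr1.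
Unshelve. all: by end_near. Qed.

(** * Differentiability of analytic functions of one variable *)

Lemma sum_half_powers_le (K : numFieldType) (N : nat) :
  \sum_(j < N) (2^-1 : K) ^+ j <= 2.
Proof.
suff -> : \sum_(j < N) (2^-1 : K) ^+ j = 2 - 2 * 2^-1 ^+ N.
  by rewrite gerBl mulr_ge0 ?exprn_ge0 ?invr_ge0.
elim: N => [|N IHN]; first by rewrite big_ord0 expr0 mulr1 subrr.
rewrite big_ord_recr/= IHN exprS mulVKf ?pnatr_eq0//; ring.
Qed.

(** Convergence at [r / 2] bounds the terms [a i * (r / 2) ^+ i] by some [B]. At radius [r / 4] the
    series is then dominated by [B] times the geometric series of ratio 1/2, which gives the
    absolute bound [B * 2]. *)
Lemma analytic_derivable (R : realType) (D : set (Cplx R)) (f : Cplx R -> Cplx R)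
    (t0 : Cplx R) :
  analytic_on D f -> D t0 -> derivable f t0 1.
Proof.
move=> fD /fD[a [r [r0 af]]].
have r20 : 0 < r / 2 by rewrite divr_gt0.
have r2r : r / 2 < r by rewrite ltr_pdivrMr// ltr_pMr// ltr1n.
have r40 : 0 < r / 2 / 2 by rewrite divr_gt0.
have r4r2 : r / 2 / 2 < r / 2 by rewrite ltr_pdivrMr// ltr_pMr// ltr1n.
have [B B0 aB] : exists2 B : Cplx R, 0 < B & forall i, `|a i * (r / 2) ^+ i| <= B.
  have /cvgP/cvg_series_cvg_0/cvgP/cvg_seq_bounded/ex_strict_bound_gt0[B B0 aB] :=
    af (r / 2) (eq_ind_r (fun x => x < r) r2r (gtr0_norm r20)).
  by exists B => // i; apply/ltW/aB.
apply: (@ex_derive _ _ _ _ _ _ (a 1%N)).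
apply: (@is_derive_lim_poly _ _ _ _ _ (B * 2) (fun _ j => a j) r40).
- move=> N; apply: le_trans (ler_wpM2l (ltW B0) (sum_half_powers_le _ N)).
  rewrite mulr_sumr; apply: ler_sum => j _.
  rewrite exprMn mulrA ler_wpM2r ?exprn_ge0 ?invr_ge0//.
  by rewrite -[X in _ * X](gtr0_norm (exprn_gt0 j r20)) -normrM.
- move=> k kr; have := af k (lt_trans kr (lt_trans r4r2 r2r)).
  by rewrite seriesEord.
- exact: cvg_cst.
Qed.

(** * The commutator of the two operators *)

(** The two compositions, expanded by the product rule at one point. [Yzt] stands for both mixed
    derivatives and cancels, as do the terms in [Yz] and [Yt]. *)
Lemma lax_mulmxE (K : comNzRingType) (n : nat) (z t : K) (A B At Bz : 'M[K]_n)
    (Y Yz Yt Yzt : 'cV[K]_n) :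
  z *: (t *: Yzt + (B *m Yz + Bz *m Y)) + A *m (t *: Yt + B *m Y)
  - (t *: (z *: Yzt + (A *m Yt + At *m Y)) + B *m (z *: Yz + A *m Y))
  = (z *: Bz - t *: At + A *m B - B *m A) *m Y.
Proof.
rewrite !(mulmxBl, mulmxDl, mulmxDr, scalerDr, mulmxA) -!scalemxAl -!scalemxAr !scalerA.
rewrite [t * z]mulrC.
(* Matrix products do not commute, so they are abstracted into vectors and [ring] is used
   entrywise. *)
have zmodE (a1 a2 a3 a4 a5 a6 a7 : 'cV[K]_n) :
    a1 + (a2 + a3) + (a4 + a5) - (a1 + (a4 + a6) + (a2 + a7)) = a3 - a6 + a5 - a7.
  by apply/matrixP => i j; rewrite !mxE; ring.
exact: zmodE.
Qed.

Section LaxPair.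
Variables (R : realType) (n : nat).
Local Notation C := (Cplx R).
Implicit Types A B : C -> C -> 'M[C]_n.

(** The common shape of a component of [tDplus B Y] as a function of [z] and of [zDplus A Y] as a
    function of [t]; [s] is the variable held fixed. *)
Lemma is_derive_addr_sum (g : C -> C) (a y : 'I_n -> C -> C) (s x dg : C)
    (da dy : 'I_n -> C) :
  is_derive x 1 g dg -> (forall k, is_derive x 1 (a k) (da k)) ->
  (forall k, is_derive x 1 (y k) (dy k)) ->
  is_derive x 1 (fun w => s * g w + \sum_k a k w * y k w)
    (s * dg + (\sum_k a k x * dy k + \sum_k da k * y k x)).
Proof.
move=> hg ha hy.
rewrite [X in is_derive _ _ X](_ : _ = (s \*: g) + \sum_k (a k * y k)); last first.
  by apply/funext => w; rewrite [RHS]/= fctE /= fct_sumE.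
apply: is_deriveD; rewrite -big_split/=.
apply: is_derive_sum => k; apply: is_derive_eq (is_deriveM (ha k) (hy k)) _.
by rewrite /GRing.scale/= [y k x * _]mulrC.
Qed.

(** The curvature of the pair: its vanishing is the Lax equation. *)
Definition laxmx A B (z t : C) : 'M[C]_n :=
  z *: \matrix_(i, j) derive1 (fun w => B w t i j) z
  - t *: \matrix_(i, j) derive1 (fun s => A z s i j) t
  + A z t *m B z t - B z t *m A z t.

(** The outer [z]-derivative falls on [B] and the outer [t]-derivative on [A]; [analytic2_derive]
    provides a single vector [yzt] for both mixed derivatives of [Y]. *)
Lemma zDplus_tDplus_comm A B (Y : vfun R n) (U : set (C * C)) (z t : C) :
  vanalytic_on U Y -> U (z, t) ->
  (forall i j, derivable (fun s => A z s i j) t 1) ->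
  (forall i j, derivable (fun w => B w t i j) z 1) ->
  zDplus A (tDplus B Y) z t - tDplus B (zDplus A Y) z t
    = laxmx A B z t *m Y z t.
Proof.
move=> UY Uzt dA dB.
have /choice[c cY] := fun i => analytic2_derive (UY i) Uzt.
have dYz i : derivable (fun w => Y w t i 0) z 1 by case: (cY i).
have dYt i : derivable (fun s => Y z s i 0) t 1 by case: (cY i).
pose yz : 'cV[C]_n := \col_i derive1 (fun w => Y w t i 0) z.
pose yt : 'cV[C]_n := \col_i derive1 (fun s => Y z s i 0) t.
pose yzt : 'cV[C]_n := \col_i c i.
have derive1P (g : C -> C) x : derivable g x 1 -> is_derive x 1 g (derive1 g x).
  by rewrite derive1E; exact: derivableP.
pose Bz : 'M[C]_n := \matrix_(i, j) derive1 (fun w => B w t i j) z.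
pose At : 'M[C]_n := \matrix_(i, j) derive1 (fun s => A z s i j) t.
have dzQ : (\col_i derive1 (fun w => tDplus B Y w t i 0) z : 'cV_n)
    = t *: yzt + (B z t *m yz + Bz *m Y z t).
  apply/colP => i; rewrite !mxE derive1E.
  rewrite [X in derive X _ _](_ : _ = fun w => t * derive1 (fun s => Y w s i 0) t +
      \sum_k B w t i k * Y w t k 0); last by apply/funext => w; rewrite !mxE.
  have [_ _ dYzt _] := cY i.
  have -> := @derive_val _ _ _ _ _ _ _ (is_derive_addr_sum t dYzt
    (fun k => derive1P _ _ (dB i k))
    (fun k => derive1P _ _ (dYz k))).
  by congr (_ + (_ + _)); apply: eq_bigr => k _; rewrite !mxE.
have dtP : (\col_i derive1 (fun s => zDplus A Y z s i 0) t : 'cV_n)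
    = z *: yzt + (A z t *m yt + At *m Y z t).
  apply/colP => i; rewrite !mxE derive1E.
  rewrite [X in derive X _ _](_ : _ = fun s => z * derive1 (fun w => Y w s i 0) z +
      \sum_k A z s i k * Y z s k 0); last by apply/funext => s; rewrite !mxE.
  have [_ _ _ dYtz] := cY i.
  have -> := @derive_val _ _ _ _ _ _ _ (is_derive_addr_sum z dYtz
    (fun k => derive1P _ _ (dA i k))
    (fun k => derive1P _ _ (dYt k))).
  by congr (_ + (_ + _)); apply: eq_bigr => k _; rewrite !mxE.
have -> : zDplus A (tDplus B Y) z t = z *: (t *: yzt + (B z t *m yz + Bz *m Y z t))
    + A z t *m (t *: yt + B z t *m Y z t) by rewrite -dzQ.
have -> : tDplus B (zDplus A Y) z t = t *: (z *: yzt + (A z t *m yt + At *m Y z t))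
    + B z t *m (z *: yz + A z t *m Y z t) by rewrite -dtP.
exact: lax_mulmxE.
Qed.

(** The commutator multiplies by [laxmx]; the constant vector [delta_mx j 0] reads off its column
    [j]. *)
Lemma commute_on_laxmx A B (U : set (C * C)) :
  (forall z t, U (z, t) -> forall i j, derivable (fun s => A z s i j) t 1) ->
  (forall z t, U (z, t) -> forall i j, derivable (fun w => B w t i j) z 1) ->
  commute_on U (zDplus A) (tDplus B) <->
  (forall z t, U (z, t) -> laxmx A B z t = 0).
Proof.
move=> dA dB; split=> [PQ z t Uzt|lax0 Y UY z t Uzt]; last first.
  apply/eqP; rewrite -subr_eq0.
  rewrite (zDplus_tDplus_comm UY Uzt (dA _ _ Uzt) (dB _ _ Uzt)).
  by rewrite lax0// mul0mx.
apply/matrixP => i j.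
have cstY : vanalytic_on U (fun _ _ => delta_mx j 0 : 'cV[C]_n).
  by move=> k; exact: analytic2_on_cst.
have := zDplus_tDplus_comm cstY Uzt (dA _ _ Uzt) (dB _ _ Uzt).
by rewrite (PQ _ cstY)// subrr -colE => /colP/(_ i); rewrite !mxE.
Qed.

End LaxPair.

(** * The matrices in cyclic form *)

Section CyclicMatrices.
Variables (R : realType) (n : nat).
Hypothesis n_ge3 : (3 <= n)%N.
Local Notation C := (Cplx R).
Implicit Types (f d : nat -> C -> C) (i j : 'I_n).

(* The entry (i, i - 1) of B is [f i t * zweight z i] and the entry (i, i + 1) of
   A is the inverse of [zweight z (i + 1)], indices being taken modulo n. *)
Definition zweight (z : C) (i : nat) : C := if i == (n - 1)%N then z else 1.

Lemma val_ordS i : ordS i = (if i == (n - 1)%N :> nat then 0 else i.+1)%N :> nat.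
Proof.
rewrite /=; case: eqP => [->|/eqP ni]; first by rewrite subn1 prednK ?modnn// ltnW// ltnW.
by rewrite modn_small//; have := ltn_ord i; lia.
Qed.

Lemma val_ord_pred i : ord_pred i = (if i == 0%N :> nat then n - 1 else i - 1)%N :> nat.
Proof.
rewrite /=; case: eqP => [->|/eqP ni]; first by rewrite modn_small; lia.
have -> : (i + n).-1 = (i - 1 + n)%N by lia.
by rewrite modnDr modn_small//; have := ltn_ord i; lia.
Qed.

Lemma eq_ord_predE i j : (j == ord_pred i) = (i == ordS j).
Proof. by rewrite eq_sym (can2_eq (@ord_predK n) (@ordSK n)). Qed.

Lemma ordS_neq i : ordS i != i.
Proof. by rewrite -(inj_eq (@ord_inj n)) val_ordS; have := ltn_ord i; case: ifP; lia. Qed.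

Lemma ord_pred_neq i : ord_pred i != i.
Proof. by rewrite eq_sym eq_ord_predE eq_sym; exact: ordS_neq. Qed.

Lemma matBE f z t i j :
  matB n f z t i j = (f i t * zweight z i) *+ (j == ord_pred i).
Proof.
rewrite mxE -(inj_eq (@ord_inj n)) val_ord_pred /zweight.
have := ltn_ord i; have := ltn_ord j.
have [i0|i0] := eqVneq (i : nat) 0%N.
  rewrite i0 /= (_ : (0 == n - 1)%N = false); last by lia.
  by case: eqP => //; rewrite ?mulr1.
have [iN|iN] := eqVneq (i : nat) (n - 1)%N.
  rewrite iN (_ : (n - 1 <= n - 2)%N = false) ?andbF/=; last by lia.
  by rewrite (_ : (n - 2 = n - 1 - 1)%N); [case: eqP | lia].
move=> jn lin; rewrite (_ : (1 <= i <= n - 2)%N) /=; last by lia.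
by case: eqP => //; rewrite ?mulr1.
Qed.

(** As [3 <= n], the indices [i], [i + 1], [i - 1] are distinct modulo [n], so at most one summand
    is nonzero and the sum agrees with the nested branches. Rows 0, [n - 1] and [n - 2] are treated
    apart: the first two contain the corners, the last one contains [1 / z]. *)
Lemma matAE f d z t i j :
  matA n f d z t i j = d i t *+ (j == i) + (zweight z (ordS i))^-1 *+ (j == ordS i)
    + (f i t * zweight z i) *+ (j == ord_pred i).
Proof.
rewrite mxE [j == i]eq_sym.
have [<-|ij] := eqVneq i j.
  rewrite [i == ordS i]eq_sym (negPf (ordS_neq i)).
  by rewrite [i == ord_pred i]eq_sym (negPf (ord_pred_neq i)) !addr0.
rewrite add0r.
rewrite -!(inj_eq (@ord_inj n)).
have {}ij : (i : nat) != j by [].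
rewrite val_ordS val_ord_pred /zweight.
have := ltn_ord i; have := ltn_ord j => jn lin.
have [i0|i0] := eqVneq (i : nat) 0%N.
  rewrite i0 in ij *.
  have n1 : (0 == n - 1)%N = false by lia.
  have n2 : (0 == n - 2)%N = false by lia.
  have n3 : (1 == n - 1)%N = false by lia.
  rewrite n1 n2 n3 /= addn1 invr1 mulr1.
  case: eqP => [j1|j1]; last by rewrite add0r; case: eqP.
  have -> : (nat_of_ord j == n - 1)%N = false by rewrite j1.
  by rewrite addr0.
have [iN|iN] := eqVneq (i : nat) (n - 1)%N.
  rewrite iN in ij *.
  have n1 : (n - 1 <= n - 3)%N = false by lia.
  have n2 : (n - 1 == n - 2)%N = false by lia.
  have n3 : (0 == n - 1)%N = false by lia.
  have n5 : (n - 1 <= n - 2)%N = false by lia.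
  have n6 : (n - 2 = n - 1 - 1)%N by lia.
  rewrite n1 n2 n3 n5 andbF n6 /= invr1.
  case: eqP => [j0|j0]; last by rewrite add0r; case: eqP.
  have -> : (nat_of_ord j == n - 1 - 1)%N = false by rewrite j0; lia.
  by rewrite addr0.
have lei : (1 <= i <= n - 2)%N by lia.
rewrite lei /= mulr1.
have [iN2|iN2] := eqVneq (i : nat) (n - 2)%N.
  have n1 : (i <= n - 3)%N = false by lia.
  have n2 : (i.+1 == n - 1)%N by lia.
  have n3 : (n - 1 = i.+1)%N by lia.
  rewrite n1 n2 n3 /= div1r.
  case: eqP => [j0|j0]; last by rewrite add0r; case: eqP.
  have -> : (nat_of_ord j == i - 1)%N = false by rewrite j0; lia.
  by rewrite addr0.
have n1 : (i <= n - 3)%N by lia.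
have n2 : (i.+1 == n - 1)%N = false by lia.
rewrite n1 n2 /= addn1 invr1.
case: eqP => [j0|j0]; last by rewrite add0r; case: eqP.
have -> : (nat_of_ord j == i - 1)%N = false by rewrite j0; lia.
by rewrite addr0.
Qed.

End CyclicMatrices.

(** * The entries of the Lax equation *)

Section LaxEquation.
Variables (R : realType) (n : nat).
Hypothesis n_ge3 : (3 <= n)%N.
Local Notation C := (Cplx R).
Implicit Types (f d : nat -> C -> C) (i j : 'I_n).

Lemma zweight_neq0 (z : C) (k : nat) : z != 0 -> zweight n z k != 0.
Proof. by rewrite /zweight; case: ifP => // _ _; exact: oner_neq0. Qed.

Lemma is_derive_matB f (z t : C) i j :
  is_derive z 1 (fun w => matB n f w t i j)
    ((f i t *+ (i == n - 1 :> nat)%N) *+ (j == ord_pred i)).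
Proof.
under eq_fun do rewrite matBE//.
apply: is_derive_mulrb; rewrite /zweight; case: (nat_of_ord i == _); last first.
  exact: is_derive_cst.
have -> : (fun w => f i t * w) = f i t \*: id by [].
apply: is_derive_eq (is_deriveZ (f i t) (is_derive_id z 1)) _.
by rewrite /GRing.scale/= mulr1.
Qed.

(** The weights depend on [z] only, so the upper diagonal is constant in [t]. *)
Lemma is_derive_matA f d (z t : C) i j :
  derivable (f i) t 1 -> derivable (d i) t 1 ->
  is_derive t 1 (fun s => matA n f d z s i j)
    (derive1 (d i) t *+ (j == i)
     + (derive1 (f i) t * zweight n z i) *+ (j == ord_pred i)).
Proof.
move=> df dd.
have -> : (fun s => matA n f d z s i j) = ((fun s => d i s *+ (j == i))
    + (fun s => (f i s * zweight n z i) *+ (j == ord_pred i)))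
    + cst ((zweight n z (ordS i))^-1 *+ (j == ordS i)).
  by apply/funext => s; rewrite matAE// addrAC.
have d1 : is_derive t 1 (fun s => d i s *+ (j == i)) (derive1 (d i) t *+ (j == i)).
  by apply: is_derive_mulrb; rewrite derive1E; exact: derivableP.
have f1 : is_derive t 1 (fun s => (f i s * zweight n z i) *+ (j == ord_pred i))
    ((derive1 (f i) t * zweight n z i) *+ (j == ord_pred i)).
  apply: is_derive_mulrb.
  have -> : (fun s => f i s * zweight n z i) = zweight n z i \*: f i.
    by apply/funext => s; rewrite mulrC.
  apply: is_derive_eq (is_deriveZ _ (derivableP df)) _.
  by rewrite /GRing.scale/= derive1E mulrC.
exact: is_derive_eq (is_deriveD (is_deriveD d1 f1) (is_derive_cst _ t 1)) (addr0 _).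
Qed.

Lemma laxmx_matAB f d (z t : C) i j : z != 0 ->
  (forall i0 : 'I_n, derivable (f i0) t 1) ->
  (forall i0 : 'I_n, derivable (d i0) t 1) ->
  laxmx (matA n f d) (matB n f) z t i j =
    (zweight n z i * ((d i t - d (ord_pred i) t + (i == n - 1 :> nat)%N%:R) * f i t
       - t * derive1 (f i) t)) *+ (j == ord_pred i)
    + (f (ordS i) t - f i t - t * derive1 (d i) t) *+ (j == i).
Proof.
move=> z0 df dd; set A := matA n f d z t; set B := matB n f z t.
(* [B] is supported on the positions [(i, ord_pred i)], so each product keeps a single term. *)
have AB : (A *m B) i j = A i (ordS j) * B (ordS j) j.
  rewrite mxE (bigD1 (ordS j))//= big1 ?addr0// => k kj.
  by rewrite matBE// eq_ord_predE (negPf kj) mulr0.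
have BA : (B *m A) i j = B i (ord_pred i) * A (ord_pred i) j.
  rewrite mxE (bigD1 (ord_pred i))//= big1 ?addr0// => k kj.
  by rewrite matBE// (negPf kj) mul0r.
have -> : laxmx (matA n f d) (matB n f) z t i j =
    z * derive1 (fun w => matB n f w t i j) z - t * derive1 (fun s => matA n f d z s i j) t
    + A i (ordS j) * B (ordS j) j - B i (ord_pred i) * A (ord_pred i) j.
  have entryE (M1 M2 M3 M4 : 'M[C]_n) : (z *: M1 - t *: M2 + M3 - M4) i j
      = z * M1 i j - t * M2 i j + M3 i j - M4 i j by rewrite !mxE.
  by rewrite entryE AB BA; congr (z * _ - t * _ + _ - _); rewrite mxE.
have -> : derive1 (fun w => matB n f w t i j) z
    = (f i t *+ (i == n - 1 :> nat)%N) *+ (j == ord_pred i).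
  by rewrite derive1E; apply: derive_val; exact: is_derive_matB.
have -> : derive1 (fun s => matA n f d z s i j) t
    = derive1 (d i) t *+ (j == i)
      + (derive1 (f i) t * zweight n z i) *+ (j == ord_pred i).
  by rewrite derive1E; apply: derive_val; exact: is_derive_matA.
rewrite /A /B !matBE// !matAE// ordSK ord_predK !eqxx !mulr1n.
rewrite (can_eq (@ordSK n)) [j == ord_pred (ord_pred i)]eq_ord_predE.
rewrite [ord_pred i == ordS j]eq_sym [ordS j == i]eq_sym -eq_ord_predE.
have zwi := zweight_neq0 i z0; have zwS := zweight_neq0 (ordS i) z0.
(* Below the diagonal, [z d/dz] multiplies the weight by 1 in row [n - 1] and by 0 elsewhere; this
   is the source of the summand [i == n - 1]. *)
have [->|jP] := eqVneq j (ord_pred i).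
  rewrite ord_predK (negPf (ord_pred_neq n_ge3 i)) [i == ord_pred i]eq_sym.
  rewrite (negPf (ord_pred_neq n_ge3 i)) /zweight.
  by case: (nat_of_ord i == _); rewrite ?mulr1n ?mulr0n; ring.
have [->|ji] := eqVneq j i; last first.
  (* Off both diagonals only the product of [B] with itself can contribute, and it cancels in the
     commutator. *)
  by rewrite !mulr0n; case: eqVneq => [->|_]; rewrite ?mulr1n ?mulr0n; ring.
(* On the diagonal, each weight meets its inverse, which leaves [f (ordS i) t - f i t]. *)
rewrite !mulr0n !mulr1n; case: eqVneq => [<-|_]; rewrite ?mulr1n ?mulr0n; field.
  by rewrite zwi zwS.
by rewrite zwi zwS.
Qed.

End LaxEquation.

(** Each entry is free of [z] up to the nonzero factor [zweight n z i], so the value [z = 1] already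
    yields all equations, and these make the entries vanish for every [z]. *)
Lemma laxmx_matAB_eq0 (R : realType) (n : nat) (f d : nat -> Cplx R -> Cplx R)
    (t : Cplx R) :
  (3 <= n)%N ->
  (forall i : 'I_n, derivable (f i) t 1) -> (forall i : 'I_n, derivable (d i) t 1) ->
  (forall z, z != 0 -> laxmx (matA n f d) (matB n f) z t = 0) <->
  (forall i : 'I_n,
    t * derive1 (f i) t = (d i t - d (ord_pred i) t + (i == n - 1 :> nat)%N%:R) * f i t
    /\ t * derive1 (d i) t = f (ordS i) t - f i t).
Proof.
move=> n_ge3 df dd; split=> [lax0 i|eqs z z0].
  have /matrixP lax1 := lax0 1 (oner_neq0 _).
  split; apply/esym/eqP; rewrite -subr_eq0.
    have := lax1 i (ord_pred i); rewrite laxmx_matAB ?oner_neq0// mxE eqxx.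
    rewrite (negPf (ord_pred_neq n_ge3 i)) mulr0n addr0 mulr1n => /eqP.
    by rewrite mulf_eq0 (negPf (zweight_neq0 _ _ (oner_neq0 _))).
  have := lax1 i i; rewrite laxmx_matAB ?oner_neq0// mxE eqxx.
  by rewrite [i == _]eq_sym (negPf (ord_pred_neq n_ge3 i)) mulr0n add0r mulr1n => ->.
apply/matrixP => i j; rewrite laxmx_matAB// mxE.
have [feq deq] := eqs i.
move/esym/eqP: feq; rewrite -subr_eq0 => /eqP ->.
move/esym/eqP: deq; rewrite -subr_eq0 => /eqP ->.
by rewrite mulr0 !mul0rn addr0.
Qed.

Theorem mainTheorem1 (R : realType) (n : nat) (n_ge3 : (3 <= n)%N)
    (D : set (Cplx R)) (domD : domain D) (D_neq0 : ~ D 0)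
    (f d : nat -> Cplx R -> Cplx R)
    (f_an : forall j, (j < n)%N -> analytic_on D (f j))
    (d_an : forall j, (j < n)%N -> analytic_on D (d j))
    (sum_d : forall t, D t -> \sum_(0 <= j < n) d j t = 0)
    (prod_f : forall t, D t -> \prod_(0 <= j < n) f j t = t) :
  commute_on [set zt : Cplx R * Cplx R | zt.1 != 0 /\ D zt.2]
    (zDplus (@matA R n f d)) (tDplus (@matB R n f))
  <->
  (forall t, D t ->
    [/\ t * (derive1 (f 0%N) t / f 0%N t) = d 0%N t - d (n - 1)%N t,
        forall j, (1 <= j <= n - 2)%N ->
          t * (derive1 (f j) t / f j t) = d j t - d (j - 1)%N t,
        t * (derive1 (f (n - 1)%N) t / f (n - 1)%N t)
          = d (n - 1)%N t - d (n - 2)%N t + 1,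
        forall j, (0 <= j <= n - 2)%N ->
          t * derive1 (d j) t = f (j + 1)%N t - f j t
      & t * derive1 (d (n - 1)%N) t = f 0%N t - f (n - 1)%N t]).

Proof.
(* A vanishing factor would force [t = 0], which lies outside [D]. *)
have f_neq0 t (j : 'I_n) : D t -> f j t != 0.
  move=> Dt; apply/eqP => fj0; have := prod_f t Dt.
  rewrite big_mkord (bigD1 j)//= fj0 mul0r => t0.
  by apply: D_neq0; rewrite t0.
have df t : D t -> forall j : 'I_n, derivable (f j) t 1.
  by move=> Dt j; apply: analytic_derivable Dt; exact: f_an.
have dd t : D t -> forall j : 'I_n, derivable (d j) t 1.
  by move=> Dt j; apply: analytic_derivable Dt; exact: d_an.
apply: iff_trans (commute_on_laxmx _ _) _.
- move=> z t [/= _ Dt] i j.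
  exact: (@ex_derive _ _ _ _ _ _ _ (is_derive_matA n_ge3 z j (df t Dt i) (dd t Dt i))).
- by move=> z t [/= _ Dt] i j; exact: (@ex_derive _ _ _ _ _ _ _ (is_derive_matB n_ge3 f z t i j)).
have divE t (i : 'I_n) (c : Cplx R) : D t ->
    t * (derive1 (f i) t / f i t) = c <-> t * derive1 (f i) t = c * f i t.
  move=> Dt; rewrite mulrA; split => [<-|->]; first by rewrite divfK// f_neq0.
  by rewrite mulfK// f_neq0.
split=> [lax0 t Dt|eqs z t [/= z0 Dt]]; last first.
  have [f0E fE fnE dE dnE] := eqs t Dt.
  move: z z0; apply/(laxmx_matAB_eq0 n_ge3 (df t Dt) (dd t Dt)) => i.
  have lin := ltn_ord i; split.
    (* Row 0 has predecessor [n - 1], row [n - 1] carries the extra 1, and the other rows show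
       neither effect. *)
    apply/(divE t i _ Dt); rewrite val_ord_pred//.
    have [i0|i0] := eqVneq (i : nat) 0%N.
      have -> : (nat_of_ord i == n - 1)%N = false by rewrite i0; lia.
      by rewrite i0 addr0.
    have [->|iN] := eqVneq (i : nat) (n - 1)%N.
      by have -> : (n - 1 - 1 = n - 2)%N by lia.
    by rewrite addr0 fE//; lia.
  rewrite val_ordS//; have [->//|iN] := eqVneq (i : nat) (n - 1)%N.
  by rewrite dE ?addn1//; lia.
(* For fixed [t] in [D], every nonzero [z] belongs to the region of commutation. *)
have /(laxmx_matAB_eq0 n_ge3 (df t Dt) (dd t Dt)) eqs :
    forall z, z != 0 -> laxmx (matA n f d) (matB n f) z t = 0.
  by move=> z z0; apply: lax0.
have ltn0 : (0 < n)%N by lia.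
have ltn1 : (n - 1 < n)%N by lia.
split.
- have [/(divE t _ _ Dt) + _] := eqs (Ordinal ltn0).
  rewrite val_ord_pred//= => ->.
  have -> : (0 == n - 1)%N = false by lia.
  by rewrite addr0.
- move=> j jn; have jlt : (j < n)%N by lia.
  have [/(divE t _ _ Dt) + _] := eqs (Ordinal jlt).
  rewrite val_ord_pred//= => ->.
  have -> : (j == n - 1)%N = false by lia.
  have -> : (j == 0)%N = false by lia.
  by rewrite addr0.
- have [/(divE t _ _ Dt) + _] := eqs (Ordinal ltn1).
  rewrite val_ord_pred//= eqxx => ->.
  have -> : (n - 1 == 0)%N = false by lia.
  by have -> : (n - 1 - 1 = n - 2)%N by lia.
- move=> j jn; have jlt : (j < n)%N by lia.
  have [_] := eqs (Ordinal jlt); rewrite val_ordS//= => ->.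
  have -> : (j == n - 1)%N = false by lia.
  by rewrite addn1.
- by have [_] := eqs (Ordinal ltn1); rewrite val_ordS//= eqxx => ->.
Qed.
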